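(* Let $k$ be a field and let $a,b,c$ be pairwise coprime positive integers such that $(a,b,c)\neq(1,1,1)$. Let $S=k[x,y,z]$ be graded by $\deg x=a$, $\deg y=b$, $\deg z=c$, and let $S_n$ be its homogeneous component of degree $n$. Consider the conditions: (C2) there exist positive integers $n,r$ satisfying $n/r<\sqrt{abc}$ and $\dim_k S_n>r(r+1)/2$; (C3) there exist positive integers $q,r$ satisfying $abcq/r<\sqrt{abc}$ and $\dim_k S_{abcq}>r(r+1)/2$. Then the following hold. (1) Assume $\sqrt{abc}\notin\mathbb{Z}$. Then (C3) holds if and only if $(a+b+c)^2>abc$. (2) Assume $\sqrt{abc}\in\mathbb{Z}$. Then (C3) holds if and only if $(a+b+c)^2>9abc$. (3) If $(a+b+c)^2>abc$, then (C2) holds. In particular, a negative curve on $X_k(a,b,c)$ exists in this case.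
   Context: Let $\mathfrak{p}=\mathfrak{p}_k(a,b,c)$ be the kernel of the $k$-algebra homomorphism $k[x,y,z]\to k[t]$, $x\mapsto t^a$, $y\mapsto t^b$, $z\mapsto t^c$; it is a homogeneous prime ideal of $S$. For $r\ge 0$, $\mathfrak{p}^{(r)}=\mathfrak{p}^rS_{\mathfrak{p}}\cap S$ is the $r$-th symbolic power, and $[\mathfrak{p}^{(r)}]_n$ is its homogeneous component of degree $n$. Let $\mathbb{P}=\mathrm{Proj}(S)$ be the weighted projective space, which is smooth at the closed point $V_+(\mathfrak{p})$, let $\pi:X=X_k(a,b,c)\to\mathbb{P}$ be the blow-up of $\mathbb{P}$ at $V_+(\mathfrak{p})$, and let $E$ be the exceptional divisor. All Weil divisors on $X$ are $\mathbb{Q}$-Cartier, so there is a $\mathbb{Q}$-valued intersection pairing. A curve means a closed irreducible reduced subvariety of dimension one. A negative curve on $X$ is a curve $C\subset X$ with $C\ne E$ and $C^2<0$. Equivalently (as recalled in the paper), a negative curve exists on $X$ if and only if there are positive integers $n,r$ with $n/r<\sqrt{abc}$ and $[\mathfrak{p}^{(r)}]_n\ne 0$. *)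

(* Defs.v *)
From HB Require Import structures.
From mathcomp Require Import all_boot all_order all_algebra.
From mathcomp Require Import reals.
From mathcomp Require Import mpoly.

Set Implicit Arguments.
Unset Strict Implicit.
Unset Printing Implicit Defensive.

Import Order.TTheory GRing.Theory Num.Theory.

Local Open Scope ring_scope.

(* [has_dim U d]: the subspace U has dimension d, i.e. it has a basis with d
   elements.  The library's [\dim] is not available for subspaces of a
   polynomial ring, which is infinite-dimensional. *)
Definition has_dim (K : fieldType) (V : lmodType K) (U : {pred V}) (d : nat)
    : Prop :=
  exists e : 'I_d -> V,
    (forall u : 'rV[K]_d, \sum_i u 0 i *: e i \in U) /\
    (forall v : V, v \in U -> exists! u : 'rV[K]_d, v = \sum_i u 0 i *: e i).

Definition irreducible_elt (A : unitRingType) (f : A) : Prop :=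
  [/\ f != 0, f \isn't a GRing.unit
    & forall g h : A, f = g * h -> g \is a GRing.unit \/ h \is a GRing.unit].

(* Membership in the r-th power of the ideal I (the whole ring for r = 0). *)
Definition ideal_power (A : comNzRingType) (I : {pred A}) (r : nat) (f : A)
    : Prop :=
  exists (m : nat) (g : 'I_m -> A) (h : 'I_m -> 'I_r -> A),
    (forall i j, h i j \in I) /\ f = \sum_(i < m) g i * \prod_(j < r) h i j.

(* Membership in P^r A_P \cap A for a prime ideal P of the domain A, where A_P
   is viewed as a subring of the fraction field of A. *)
Definition symbolic_power (A : idomainType) (P : {pred A}) (r : nat) (f : A)
    : Prop :=
  exists g s : A,
    [/\ ideal_power P r g, s \notin P & tofrac f = tofrac g / tofrac s].

Definition wdeg (a b c : nat) (m : 'X_{1..3}) : nat :=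
  (\sum_(i < 3) tnth [tuple a; b; c] i * m i)%N.

Lemma wdeg0 (a b c : nat) : wdeg a b c 0%MM = 0%N.
Proof. by apply: big1 => i _; rewrite mnm0E muln0. Qed.

Lemma wdegD (a b c : nat) : {morph wdeg a b c : m1 m2 / (m1 + m2)%MM >-> (m1 + m2)%N}.
Proof.
by move=> m1 m2; rewrite -big_split /=; apply: eq_bigr => i _; rewrite mnmDE mulnDr.
Qed.

HB.instance Definition _ (a b c : nat) :=
  isMeasure.Build 3 (wdeg a b c) (wdeg0 a b c) (@wdegD a b c).

Section WeightedPlane.

Variables (k : fieldType) (a b c : nat).

Local Notation S := {mpoly k[3]}.

Definition homog_comp (n : nat) : {pred S} :=
  [pred f : S | f \is n.-homog for (wdeg a b c)].

Definition curve_map : S -> {poly k} :=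
  mmap (@polyC k) (tnth [tuple 'X^a; 'X^b; 'X^c]).

Definition curve_ideal : {pred S} := [pred f : S | curve_map f == 0].

Definition condC2 (R : realType) : Prop :=
  exists n r d : nat,
    [/\ (0 < n)%N, (0 < r)%N,
        n%:R / r%:R < Num.sqrt (a * b * c)%:R :> R,
        has_dim (homog_comp n) d
      & ((r * (r + 1)) %/ 2 < d)%N].

Definition condC3 (R : realType) : Prop :=
  exists q r d : nat,
    [/\ (0 < q)%N, (0 < r)%N,
        (a * b * c * q)%:R / r%:R < Num.sqrt (a * b * c)%:R :> R,
        has_dim (homog_comp (a * b * c * q)) d
      & ((r * (r + 1)) %/ 2 < d)%N].

(* The blow-up X of Proj S at V_+(p) is handled through its divisor classes:
   (u, v) stands for the class uH + vE, where H is the pullback of O(1) and E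
   the exceptional divisor.  The pairing is determined by H^2 = 1/(abc),
   H.E = 0 and E^2 = -1. *)
Definition intersection (D1 D2 : int * int) : rat :=
  (D1.1 * D2.1)%:~R / (a * b * c)%:R - (D1.2 * D2.2)%:~R.

(* V_+(f) has multiplicity r at the point V_+(p). *)
Definition has_multiplicity (f : S) (r : nat) : Prop :=
  symbolic_power curve_ideal r f /\ ~ symbolic_power curve_ideal r.+1 f.

(* The curves C <> E on X are the strict transforms of the curves V_+(f) in
   Proj S with f homogeneous and irreducible (S is factorial); if f has degree
   n and multiplicity r, the class of C is nH - rE. *)
Definition negative_curve (f : S) : Prop :=
  irreducible_elt f /\
  exists n r : nat,
    let C : int * int := (n%:Z, - r%:Z) in
    [/\ f \in homog_comp n, has_multiplicity f r & intersection C C < 0].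

Definition has_negative_curve : Prop := exists f : S, negative_curve f.

End WeightedPlane.

(* Main.v *)
Require Import Defs.
From HB Require Import structures.
From mathcomp Require Import all_boot all_order all_algebra.
From mathcomp Require Import reals.
From mathcomp Require Import mpoly.
From mathcomp Require Import zify ring lra.
Import Order.TTheory GRing.Theory Num.Theory.
Local Open Scope ring_scope.

(** Write D = abc and s = a + b + c. Counting lattice points gives
    2 dim S_(n + Dq) = 2 dim S_n + 2qn + D q^2 + s q; for n = 0 this turns (C3)
    into: r > q sqrt D and r^2 + r < D q^2 + s q + 2 for some q, r > 0. If
    sqrt D is irrational, r - q sqrt D can be made positive and arbitrarily
    small, so that s > sqrt D suffices; if sqrt D = t, the best choice is
    r = tq + 1, and the condition becomes s > 3t.

    For (C2) with sqrt D = t take n = t - 1 + 3D and r = 3t + 1, which works as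
    soon as s >= t + 3. Here a, b, c are squares x^2, y^2, z^2 with t = xyz, and
    x^2 + y^2 + z^2 = xyz + d with d = 1, 2 has only the solution (1, 1, 1), by
    Vieta descent.

    For the negative curve choose p, q with ap - bq = 1. The substitution
    x = T^a (1+U)^q, y = T^b (1+U)^p, z = T^c (1+V) is an isomorphism of tori
    which maps the curve to U = V = 0, so the r-th symbolic power consists of
    the forms of order at least r in (U, V). On S_n this is r(r+1)/2 linear
    conditions, hence (C2) gives a nonzero form with n^2 < D r^2, and one of
    minimal degree is irreducible since the order is additive. *)

(** * Lattice points in weighted triangles *)

(* On generating functions: division by [1 - T^a]. *)
Definition stretch (a : nat) (F : nat -> rat) (M : nat) : rat :=
  \sum_(0 <= i < (M %/ a).+1) F (M - a * i)%N.

(** The series 1. Stretching it by c, b and a gives 1 / ((1 - T^a)(1 - T^b)(1 - T^c)), the Hilbert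
    series of S. *)
Definition kronecker (M : nat) : rat := (M == 0%N)%:R.

Lemma stretch_bound (a N : nat) (F : nat -> rat) (M : nat) :
  (0 < a)%N -> (M < a * N)%N ->
  \sum_(0 <= i < N) (if (a * i <= M)%N then F (M - a * i)%N else 0)
    = stretch a F M.
Proof.
move=> a0 MN; have le : ((M %/ a).+1 <= N)%N by rewrite ltn_divLR // mulnC.
rewrite (@big_cat_nat _ _ _ (M %/ a).+1) //= [X in _ + X]big1_seq ?addr0 => [|i]; last first.
  rewrite mem_index_iota ltn_divLR // mulnC => /andP[_ /andP[h _]].
  by rewrite leqNgt h.
apply: eq_big_nat => i /andP[_]; rewrite ltnS leq_divRL // mulnC.
by move=> ->.
Qed.

Lemma stretch_shift (a m : nat) (F : nat -> rat) (M : nat) : (0 < a)%N ->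
  stretch a F (M + a * m) =
  stretch a F M + \sum_(i < m) F (M + a * i.+1)%N.
Proof.
move=> a0; rewrite /stretch.
have -> : ((M + a * m) %/ a = m + M %/ a)%N by rewrite addnC mulnC divnMDl.
rewrite -addnS.
rewrite (@big_cat_nat _ _ _ m) ?leq_addr //= addrC; congr (_ + _).
  rewrite -{1}[m]add0n big_addn addKn.
  by apply: eq_bigr => i _; congr F; lia.
rewrite big_nat_rev /= big_mkord; apply: eq_bigr => i _; congr F.
have := ltn_ord i; nia.
Qed.

(** As a is a unit modulo m, the indices M + a (i + 1) run through every residue class once. *)
Lemma sum_residues (a m M : nat) (G : nat -> rat) :
  (0 < m)%N -> coprime a m ->
  \sum_(i < m) G ((M + a * i.+1) %% m)%N = \sum_(i < m) G i.
Proof.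
move=> m0 cop.
pose h (i : 'I_m) : 'I_m := Ordinal (ltn_pmod (M + a * i.+1) m0).
have hinj : injective h.
  move=> i j /(congr1 val) /= /eqP; rewrite eqn_modDl.
  wlog le : i j / (i <= j)%N => [W|].
    by case/orP: (leq_total i j) => le E; [|symmetry]; apply: W; rewrite // eq_sym.
  rewrite eq_sym eqn_mod_dvd; last by rewrite leq_mul2l ltnS le orbT.
  rewrite -mulnBr subSS Gauss_dvdr 1?coprime_sym // => d.
  apply/val_inj/eqP; rewrite eqn_leq le /= -subn_eq0.
  apply: contraTT d; rewrite -lt0n => p; rewrite gtnNdvd //.
  by apply: leq_ltn_trans (leq_subr _ _) (ltn_ord j).
by rewrite [RHS](reindex_inj hinj).
Qed.

Lemma sum_ord_rat (m : nat) : \sum_(i < m) (i%:R : rat) = m%:R * (m%:R - 1) / 2.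
Proof.
elim: m => [|m IH]; first by rewrite big_ord0 !mul0r.
by rewrite big_ord_recr /= IH -natr1; field.
Qed.

(** Removing the linear part of slope al / m leaves an m-periodic [G], whose sum [sum_residues]
    computes; the linear part is an arithmetic progression. *)
Lemma quasilinear_sum (a m M : nat) (F : nat -> rat) (al : rat) :
  (0 < m)%N -> coprime a m -> (forall N, F (N + m)%N = F N + al) ->
  \sum_(i < m) F (M + a * i.+1)%N =
  al * M%:R + al * a%:R * (m%:R + 1) / 2 - al * (m%:R - 1) / 2
    + \sum_(i < m) F i.
Proof.
move=> m0 cop Fm; have mn0 : (m%:R : rat) != 0 by rewrite pnatr_eq0 -lt0n.
pose G N := F N - al * N%:R / m%:R.
have GM N : G (N %% m)%N = G N.
  rewrite {2}(divn_eq N m) addnC; elim: (N %/ m)%N => [|q IH].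
    by rewrite mul0n addn0.
  by rewrite mulSn addnCA addnC IH /G Fm natrD; field.
have -> : \sum_(i < m) F (M + a * i.+1)%N =
   \sum_(i < m) (G ((M + a * i.+1) %% m)%N + al * (M + a * i.+1)%:R / m%:R).
  by apply: eq_bigr => i _; rewrite GM /G; ring.
rewrite [LHS]big_split [LHS]/= sum_residues //.
have -> : \sum_(i < m) F i = \sum_(i < m) (G i + al * i%:R / m%:R).
  by apply: eq_bigr => i _; rewrite /G; ring.
rewrite [X in _ = _ + X]big_split [RHS]/=; move: (\sum_(i < m) G i) => S.
rewrite -!mulr_suml -!mulr_sumr sum_ord_rat.
have -> : \sum_(i < m) ((M + a * i.+1)%:R : rat) =
   \sum_(i < m) ((M + a)%:R + a%:R * i%:R).
  by apply: eq_bigr => i _; rewrite mulnS natrD natrD natrM natrD; ring.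
rewrite big_split /= -mulr_sumr sum_ord_rat sumr_const card_ord -mulr_natr natrD.
by field.
Qed.

(** Taking partial sums is division by 1 - T, which commutes with division by 1 - T^b. Truncated
    subtraction makes the terms with b i >= M empty. *)
Lemma sum_stretch (b N M : nat) (F : nat -> rat) : (0 < b)%N -> (M <= b * N)%N ->
  \sum_(i < M) stretch b F i = \sum_(i < N) \sum_(j < M - b * i) F j.
Proof.
move=> b0; elim: M => [_|M IH le].
  by rewrite big_ord0 big1 // => i _; rewrite sub0n big_ord0.
rewrite big_ord_recr /= IH; last exact: ltnW.
rewrite -(@stretch_bound _ N) // big_mkord -big_split /=; apply: eq_bigr => i _.
case: leqP => h; first by rewrite subSn // big_ord_recr.
have /eqP -> : (M.+1 - b * i == 0)%N by rewrite subn_eq0.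
have /eqP -> : (M - b * i == 0)%N by rewrite subn_eq0 ltnW.
by rewrite !big_ord0 addr0.
Qed.

Section Triangle.
Variables a b c : nat.
Hypotheses (a0 : (0 < a)%N) (b0 : (0 < b)%N) (c0 : (0 < c)%N).
Hypotheses (hab : coprime a b) (hac : coprime a c) (hbc : coprime b c).

(** [P1] has period c, [P2] gains 1 over bc, [P3] gains a linear function over abc; the last two
    laws follow from the preceding one by [stretch_shift] and [quasilinear_sum]. *)
Let P1 := stretch c kronecker.
Let P2 := stretch b P1.
Let P3 := stretch a P2.

Let P1_shift N : P1 (N + c) = P1 N.
Proof.
rewrite -{1}[c]muln1 /P1 stretch_shift // big_ord1 muln1 /kronecker.
by rewrite addn_eq0 (gtn_eqF c0) andbF addr0.
Qed.

Let P1_small i : (i < c)%N -> P1 i = kronecker i.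
Proof. by move=> h; rewrite /P1 /stretch divn_small // big_nat1 muln0 subn0. Qed.

Let sum_P1_small m : (m <= c)%N -> \sum_(i < m) P1 i = (m != 0%N)%:R.
Proof.
case: m => [|m] h; first by rewrite big_ord0.
rewrite big_ord_recl big1 => [|i _]; rewrite P1_small ?addr0 //.
exact: leq_trans h.
Qed.

Let P2_shift N : P2 (N + b * c) = P2 N + 1.
Proof.
rewrite /P2 stretch_shift // (@quasilinear_sum _ _ _ _ 0) //; last first.
  by move=> ?; rewrite addr0; apply: P1_shift.
by rewrite sum_P1_small // -lt0n c0 /= !mul0r subr0 !add0r.
Qed.

(** Exchanging sums leaves the partial sums [C] of [P1], which gain 1 over each period c, so
    [quasilinear_sum] applies to them. *)
Let sum_P2 : \sum_(i < b * c) P2 i = (b%:R * c%:R + b%:R + c%:R - 1) / 2.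
Proof.
rewrite /P2 (@sum_stretch _ c) //; pose C M := \sum_(j < M) P1 j.
have -> : \sum_(i < c) \sum_(j < b * c - b * i) P1 j =
   \sum_(i < c) C (0 + b * i.+1)%N.
  rewrite -(big_mkord predT (fun i => \sum_(j < b * c - b * i) P1 j)) big_nat_rev big_mkord.
  by apply: eq_bigr => i _; rewrite add0n -mulnBr subKn.
rewrite (@quasilinear_sum _ _ _ _ 1) //.
  have -> : \sum_(i < c) C i = c%:R - 1.
    have -> : \sum_(i < c) C i = \sum_(i < c) (i != 0 :> nat)%:R.
      by apply: eq_bigr => i _; rewrite /C sum_P1_small // ltnW.
    case: (c) c0 => // d _; rewrite big_ord_recl add0r.
    by rewrite (eq_bigr (fun=> 1)) // sumr_const card_ord -natr1 addrK.
  by field.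
move=> N; rewrite /C -(big_mkord predT P1) (@big_cat_nat _ _ _ c) ?leq_addl //=.
rewrite addrC big_mkord sum_P1_small // -lt0n c0; congr (_ + _).
rewrite -{1}[c]add0n big_addn addnK big_mkord.
by apply: eq_bigr => i _; rewrite P1_shift.
Qed.

Let P3_shift N :
  P3 (N + a * b * c) = P3 N + N%:R + (a * b * c + (a + b + c))%:R / 2.
Proof.
have bc0 : (0 < b * c)%N by rewrite muln_gt0 b0.
rewrite -mulnA /P3 stretch_shift // (@quasilinear_sum _ _ _ _ 1) ?coprimeMr ?hab //.
by rewrite sum_P2 !(natrD, natrM); field.
Qed.

Lemma lattice_points_shift q N :
  stretch a (stretch b (stretch c kronecker)) (N + a * b * c * q) =
  stretch a (stretch b (stretch c kronecker)) N
   + q%:R * N%:R + ((a * b * c) * q ^ 2 + (a + b + c) * q)%:R / 2.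
Proof.
elim: q => [|q IH]; first by rewrite {1}muln0 addn0 !(natrD, natrM, natrX); field.
rewrite mulnS (addnC (a * b * c)%N) addnA -/P1 -/P2 -/P3 P3_shift /P3 /P2 /P1 IH.
by rewrite !(natrD, natrM, natrX) -[q.+1%:R]natr1; field.
Qed.

Lemma lattice_points0 : stretch a (stretch b (stretch c kronecker)) 0 = 1.
Proof. by rewrite /stretch !(div0n, big_nat1, muln0, subn0). Qed.

Lemma stretch_ge0 e F M : (forall N, 0 <= F N) -> 0 <= stretch e F M.
Proof. by move=> F0; apply: sumr_ge0. Qed.

Lemma lattice_points_ge0 N : 0 <= stretch a (stretch b (stretch c kronecker)) N.
Proof. by do 3!apply: stretch_ge0 => ?; rewrite /kronecker ler0n. Qed.

(** Sums out one variable: X is the degree used up by the variables still to be summed, and [n < N]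
    leaves enough terms. *)
Let stretch_weight n N e (g F : nat -> rat) : (0 < e)%N -> (n < N)%N ->
  (forall X, g X = if (X <= n)%N then F (n - X)%N else 0) ->
  forall X, \sum_(i < N) g (X + e * i)%N =
    if (X <= n)%N then stretch e F (n - X) else 0.
Proof.
move=> e0 nN gE X; case: leqP => h; last first.
  by rewrite big1 // => i _; rewrite gE leqNgt ltn_addr.
rewrite -(@stretch_bound _ N) //; last first.
  by apply: leq_ltn_trans (leq_subr _ _) (leq_trans nN _); rewrite leq_pmull.
rewrite big_mkord; apply: eq_bigr => i _.
by rewrite gE leq_subRL // subnDA.
Qed.

Lemma lattice_points_sum n :
  (\sum_(i < n.+1) \sum_(j < n.+1) \sum_(l < n.+1)
     (a * i + b * j + c * l == n)%:R : rat)
  = stretch a (stretch b (stretch c kronecker)) n.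
Proof.
have H0 X : (X == n)%:R = if (X <= n)%N then kronecker (n - X) else 0.
  by rewrite /kronecker subn_eq0; case: ltngtP.
have H1 := stretch_weight _ _ _ _ _ c0 (ltnSn n) H0.
have H2 := stretch_weight _ _ _ _ _ b0 (ltnSn n) H1.
have /(_ 0%N) := stretch_weight _ _ _ _ _ a0 (ltnSn n) H2.
by rewrite leq0n subn0 => <-.
Qed.

End Triangle.

(** * Dimensions *)

(** Expand the first basis in the second. A nonzero row vector killed by the coordinate matrix would
    give a second expansion of 0, so the matrix is row free and has at most as many rows as
    columns. *)
Lemma has_dim_leq (K : fieldType) (V : lmodType K) (U : {pred V}) (d d' : nat) :
  has_dim U d -> has_dim U d' -> (d <= d')%N.
Proof.
move=> [e [eU eB]] [e' [e'U e'B]].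
have e_in i : e i \in U.
  have := eU (delta_mx 0 i); rewrite (bigD1 i) //= mxE !eqxx scale1r.
  rewrite big1 ?addr0 // => j ji.
  by rewrite mxE (negPf ji) andbF scale0r.
have /fin_all_exists[u Hu] i : exists u : 'rV[K]_d', e i = \sum_j u 0 j *: e' j.
  by have [u [Hu _]] := e'B _ (e_in i); exists u.
pose B := \matrix_(i, j) u i 0 j.
have : row_free B.
  apply: inj_row_free => v vB.
  have z : \sum_i v 0 i *: e i = 0.
    have -> : \sum_i v 0 i *: e i = \sum_j (v *m B) 0 j *: e' j.
      under eq_bigr do rewrite Hu scaler_sumr.
      rewrite exchange_big; apply: eq_bigr => j _.
      rewrite mxE scaler_suml; apply: eq_bigr => i _.
      by rewrite !mxE scalerA.
    by rewrite vB big1 // => j _; rewrite mxE scale0r.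
  have zU : 0 \in U by rewrite -z; apply: eU.
  have [w [_ w_uniq]] := eB _ zU.
  rewrite -(w_uniq v) //; apply: w_uniq; rewrite big1 // => j _.
  by rewrite mxE scale0r.
by rewrite /row_free => /eqP {1}<-; apply: rank_leq_col.
Qed.

Lemma has_dim_uniq (K : fieldType) (V : lmodType K) (U : {pred V}) (d d' : nat) :
  has_dim U d -> has_dim U d' -> d = d'.
Proof. by move=> h h'; apply/eqP; rewrite eqn_leq !(@has_dim_leq _ _ U). Qed.

Lemma wdegE (a b c : nat) (m : 'X_{1..3}) :
  wdeg a b c m = (a * m 0%R + b * m 1%R + c * m (2%:R : 'I_3)%R)%N.
Proof.
rewrite /wdeg !big_ord_recl big_ord0 addn0 addnA /=.
by congr (_ * m _ + _ * m _ + _ * m _)%N; apply: val_inj.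
Qed.

Section Hilbert.
Variables (k : fieldType) (a b c : nat).
Hypotheses (a0 : (0 < a)%N) (b0 : (0 < b)%N) (c0 : (0 < c)%N).

Let mon n (x : 'I_n.+1 * 'I_n.+1 * 'I_n.+1) : 'X_{1..3} :=
  [multinom tnth [tuple x.1.1 : nat; x.1.2 : nat; x.2 : nat] i | i < 3].

Let monE n x : [/\ @mon n x 0%R = x.1.1, @mon n x 1%R = x.1.2
  & @mon n x (2%:R : 'I_3)%R = x.2].
Proof. by rewrite /mon !mnmE. Qed.

Let mon_inj n : injective (@mon n).
Proof.
move=> [[i j] l] [[i' j'] l'] E; have := monE _ (i, j, l); rewrite E.
have [-> -> ->] := monE _ (i', j', l') => -[/= h1 h2 h3].
by congr (_, _, _); apply/val_inj.
Qed.

Lemma has_dim_homog n : exists2 d : nat,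
  has_dim (@homog_comp k a b c n) d &
  d%:R = stretch a (stretch b (stretch c kronecker)) n.
Proof.
pose A := [set x : 'I_n.+1 * 'I_n.+1 * 'I_n.+1 | wdeg a b c (mon n x) == n].
exists #|A|; last first.
  rewrite -lattice_points_sum // pair_bigA /= pair_bigA /= -sum1_card big_mkcond.
  rewrite raddf_sum /=; apply: eq_bigr => -[[i j] l] _.
  rewrite inE wdegE; have [-> -> ->] := monE _ (i, j, l).
  by case: eqP.
pose e (i : 'I_#|A|) : {mpoly k[3]} := 'X_[mon n (enum_val i)].
have coefE (u : 'rV[k]_#|A|) j :
    (\sum_i u 0 i *: e i)@_(mon n (enum_val j)) = u 0 j.
  rewrite raddf_sum (bigD1 j) //= mcoeffZ mcoeffX eqxx mulr1 big1 ?addr0 // => i ij.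
  rewrite mcoeffZ mcoeffX (inj_eq (@mon_inj n)) (inj_eq enum_val_inj).
  by rewrite (negPf ij) mulr0.
exists e; split=> [u|v].
  rewrite inE; apply: rpred_sum => i _; rewrite rpredZ // dhomogX.
  by have := enum_valP i; rewrite inE.
rewrite inE => /dhomogP vh; exists (\row_i v@_(mon n (enum_val i))); split; last first.
  by move=> u ->; apply/rowP => j; rewrite mxE coefE.
apply/mpolyP => m; have [mv|mv] := boolP (wdeg a b c m == n); last first.
  have -> : v@_m = 0 by apply: memN_msupp_eq0; apply: contra mv => /vh ->.
  rewrite raddf_sum big1 // => i _; rewrite /= mcoeffZ mcoeffX.
  case: eqP => [E|]; last by rewrite mulr0.
  by have := enum_valP i; rewrite inE E (negPf mv).
(* Positive weights bound every exponent of a monomial of degree n by n, so the box loses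
   nothing. *)
have bd : [/\ (m 0%R < n.+1)%N, (m 1%R < n.+1)%N & (m (2%:R : 'I_3)%R < n.+1)%N].
  move: mv; rewrite wdegE => /eqP <-; rewrite !ltnS; split; nia.
case: bd => b1 b2 b3; pose x := (Ordinal b1, Ordinal b2, Ordinal b3).
have mE : mon n x = m.
  apply/mnmP => i; rewrite mnmE; case: i => -[|[|[]]] //= h; congr (m _);
    exact: val_inj.
have xA : x \in A by rewrite inE mE.
by rewrite -mE -[x](enum_rankK_in xA) // coefE mxE.
Qed.

End Hilbert.

(** * Condition (C3) as an inequality between integers *)

Section RealSqrt.
Variable R : realType.

Lemma ratio_lt_sqrt (n r D : nat) : (0 < r)%N ->
  (n%:R / r%:R < Num.sqrt D%:R :> R) = (n ^ 2 < D * r ^ 2)%N.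
Proof.
move=> r0; rewrite -(@ltr_pXn2r _ 2) ?nnegrE ?sqrtr_ge0 ?divr_ge0 ?ler0n //.
rewrite sqr_sqrtr ?ler0n // expr_div_n ltr_pdivrMr ?exprn_gt0 ?ltr0n //.
by rewrite -!natrX -natrM ltr_nat.
Qed.

Lemma sqrt_natP (D : nat) :
  reflect (exists t : nat, D = (t ^ 2)%N) ((Num.sqrt D%:R : R) \is a Num.int).
Proof.
apply: (iffP idP) => [|[t ->]]; last by rewrite natrX sqrtr_sqr normr_nat rpred_nat.
rewrite intrEge0 ?sqrtr_ge0 // => /natrP[t tE]; exists t.
by apply/eqP; rewrite -(eqr_nat R) natrX -tE sqr_sqrtr.
Qed.

(** [lattice_points_shift] at N = 0 gives 2d = D q^2 + s q + 2, and squaring D q < r sqrt D allows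
    one factor D to be cancelled. *)
Lemma condC3E (k : fieldType) (a b c : nat) :
  (0 < a)%N -> (0 < b)%N -> (0 < c)%N ->
  coprime a b -> coprime a c -> coprime b c ->
  condC3 k a b c R <-> exists q r : nat, [/\ (0 < q)%N, (0 < r)%N,
    (a * b * c * q ^ 2 < r ^ 2)%N &
    (r * (r + 1) < a * b * c * q ^ 2 + (a + b + c) * q + 2)%N].
Proof.
move=> a0 b0 c0 hab hac hbc.
have D0 : (0 < a * b * c)%N by rewrite !muln_gt0 a0 b0.
have ltE q r : (0 < r)%N -> ((a * b * c * q)%:R / r%:R < Num.sqrt (a * b * c)%:R :> R)
    = (a * b * c * q ^ 2 < r ^ 2)%N.
  move=> r0; rewrite ratio_lt_sqrt // expnMn -[((a * b * c) ^ 2)%N]mulnn -mulnA.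
  by rewrite ltn_pmul2l.
have dimE q d : has_dim (@homog_comp k a b c (a * b * c * q)) d ->
    (2 * d)%N = (a * b * c * q ^ 2 + (a + b + c) * q + 2)%N.
  move=> hd; have [d' hd' d'E] := has_dim_homog k a b c a0 b0 c0 (a * b * c * q).
  rewrite (has_dim_uniq _ _ _ _ _ hd hd'); apply/eqP; rewrite -(eqr_nat rat) natrM d'E.
  have := lattice_points_shift _ _ _ a0 b0 c0 hab hac hbc q 0.
  by rewrite add0n lattice_points0 => ->; rewrite [in X in _ == X]natrD; apply/eqP; field.
have halfE u v : ((u * (u + 1)) %/ 2 < v)%N = (u * (u + 1) < 2 * v)%N.
  by rewrite ltn_divLR // [(2 * v)%N]mulnC.
split.
  move=> [q [r [d [q0 r0 lt hd hr]]]].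
  by exists q, r; rewrite -ltE // -(dimE q d) // -halfE.
move=> [q [r [q0 r0 lt hr]]].
have [d0 hd _] := has_dim_homog k a b c a0 b0 c0 (a * b * c * q).
by exists q, r, d0; rewrite ltE // halfE (dimE q d0).
Qed.

End RealSqrt.

(** * Arithmetic of the numerical conditions *)

Lemma expr_lt_eps (R : archiRealFieldType) (y eps : R) :
  0 < y < 1 -> 0 < eps -> exists m : nat, y ^+ m < eps.
Proof.
move=> /andP[y0 y1] e0.
(* A form of Bernoulli's inequality: the powers of 1/y grow at least linearly. *)
have bern m : y ^+ m * (1 + m%:R * (1 - y)) <= 1.
  elim: m => [|m IH]; first by rewrite expr0 mul0r addr0 mulr1.
  have h : 0 <= (m%:R + 1) * (1 - y) ^+ 2 :> R by rewrite mulr_ge0 ?sqr_ge0 ?addr_ge0 ?ler0n.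
  apply: le_trans IH; rewrite exprSr -mulrA ler_pM2l ?exprn_gt0 // -natr1; lra.
pose N := Num.bound (eps * (1 - y))^-1.
have Nb : 1 < eps * (N%:R * (1 - y)).
  have p : 0 < eps * (1 - y) by rewrite mulr_gt0 ?subr_gt0.
  rewrite mulrCA mulrC -ltr_pdivrMl // mulr1.
  by apply: archi_boundP; rewrite invr_ge0 ltW.
exists N; have := bern N; have := exprn_gt0 N y0.
set z := y ^+ N; set u := N%:R * (1 - y) in Nb *; nra.
Qed.

(* A power of [x = w - floor w] has the form [r - q w]; since the exponent is
   even it is positive whatever the sign of [x]. *)
Lemma approx_sqrt (R : archiRealFieldType) (D : nat) (w eps : R) :
  w ^+ 2 = D%:R -> 0 < w -> (forall t : nat, D <> (t ^ 2)%N) -> 0 < eps ->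
  exists q r : nat, [/\ (0 < q)%N, (0 < r)%N & 0 < r%:R - q%:R * w < eps].
Proof.
move=> w2 w0 Dns e0; pose f := Num.truncn w.
have /andP[fw wf] := truncn_itv (ltW w0).
have f0 : (0 < f)%N.
  rewrite truncn_gt0 -(@ler_pXn2r _ 2) ?nnegrE ?ler01 ?(ltW w0) // expr1n w2.
  by rewrite ler1n lt0n; apply/eqP => D0; apply: (Dns 0%N).
have fw' : f%:R < w.
  rewrite lt_neqAle fw andbT; apply/eqP => E; apply: (Dns f).
  by apply/eqP; rewrite -(eqr_nat R) natrX E w2.
pose y := (w - f%:R) ^+ 2.
have y0 : 0 < y by rewrite exprn_gt0 // subr_gt0.
have y1 : y < 1 by rewrite /y expr_lt1 // ?subr_ge0 ?ltW // ltrBlDl natr1.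
have [|m ym] := @expr_lt_eps _ y eps _ e0; first by rewrite y0.
(* The exponent m.+1 avoids y^0 = 1, which would give q = 0. *)
have [q [r [q0 r0 E]]] : exists q r : nat,
    [/\ (0 < q)%N, (0 < r)%N & r%:R - q%:R * w = y ^+ m.+1].
  elim: (m) => [|{m ym} m [q [r [q0 r0 E]]]].
    (* y = (w - f)^2 = (D + f^2) - 2 f w. *)
    exists (2 * f)%N, (D + f ^ 2)%N; rewrite muln_gt0 f0 addn_gt0 expn_gt0 f0 orbT.
    by split=> //; rewrite expr1 /y natrD -w2 natrX natrM; ring.
  (* The product of (D + f^2) - 2 f w and r - q w, with w^2 = D. *)
  exists ((D + f ^ 2) * q + 2 * f * r)%N, ((D + f ^ 2) * r + 2 * f * D * q)%N.
  split; rewrite ?addn_gt0 ?muln_gt0 ?addn_gt0 ?expn_gt0 ?f0 ?r0 ?q0 ?orbT //.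
  by rewrite exprS -E /y !(natrD, natrM, natrX) -w2; ring.
exists q, r; split=> //; rewrite E (exprn_gt0 _ y0) /=.
by apply: le_lt_trans ym; rewrite exprS -[leRHS]mul1r ler_pM2r ?(exprn_gt0 _ y0) // ltW.
Qed.

(** If s^2 <= D, then s q < r; adding this to D q^2 < r^2 gives r (r + 1) >= D q^2 + s q + 2. *)
Lemma sum_sq_gt_of_points (D s q r : nat) : (0 < q)%N ->
  (D * q ^ 2 < r ^ 2)%N -> (r * (r + 1) < D * q ^ 2 + s * q + 2)%N -> (D < s ^ 2)%N.
Proof.
move=> q0 lt hr; rewrite ltnNge; apply/negP => sD.
have : (s * q < r)%N.
  rewrite -ltn_sqr; apply: leq_ltn_trans lt.
  by rewrite expnMn leq_mul2r sD orbT.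
nia.
Qed.

Lemma points_of_sum_sq_gt (R : realType) (D s : nat) : (forall t : nat, D <> (t ^ 2)%N) ->
  (D < s ^ 2)%N -> exists q r : nat, [/\ (0 < q)%N, (0 < r)%N,
    (D * q ^ 2 < r ^ 2)%N & (r * (r + 1) < D * q ^ 2 + s * q + 2)%N].
Proof.
move=> Dns Ds; pose w : R := Num.sqrt D%:R.
have w2 : w ^+ 2 = D%:R by rewrite sqr_sqrtr ?ler0n.
have w0 : 0 < w.
  by rewrite sqrtr_gt0 ltr0n lt0n; apply/eqP => D0; apply: (Dns 0%N).
have ws : w < s%:R.
  by rewrite -(@ltr_pXn2r _ 2) ?nnegrE ?ler0n ?ltW // w2 -natrX ltr_nat.
(* For r = q w + e the excess r^2 + r - D q^2 is q (2 e w + w) + e^2 + e; the two bounds on e make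
   it smaller than s q + 2. *)
have e0 : 0 < Num.min 1 ((s%:R - w) / (2 * w)).
  by rewrite lt_min ltr01 divr_gt0 ?subr_gt0 ?mulr_gt0.
have [q [r [q0 r0 /andP[]]]] := approx_sqrt _ _ _ _ w2 w0 Dns e0.
set e := r%:R - q%:R * w => ep; rewrite lt_min => /andP[e1].
rewrite ltr_pdivlMr ?mulr_gt0 // => es.
have rE : r%:R = q%:R * w + e :> R by rewrite /e addrC subrK.
have h1 : q%:R * (e * (2 * w)) < q%:R * (s%:R - w) by rewrite ltr_pM2l ?ltr0n.
have h2 : e * e < 1 by rewrite mulr_ilt1 // ltW.
have h3 : 0 < q%:R * w by rewrite mulr_gt0 ?ltr0n.
exists q, r; split => //; rewrite -(ltr_nat R) !(natrD, natrM, natrX) rE -w2; first nra.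
lra.
Qed.

Lemma points_square (t s : nat) :
  (exists q r : nat, [/\ (0 < q)%N, (0 < r)%N,
    (t ^ 2 * q ^ 2 < r ^ 2)%N & (r * (r + 1) < t ^ 2 * q ^ 2 + s * q + 2)%N]) <->
  (3 * t < s)%N.
Proof.
split=> [[q [r [q0 r0 lt hr]]]|st]; last first.
  by exists 1%N, t.+1; split; rewrite ?exp1n //; nia.
have tr : (t * q < r)%N by rewrite -ltn_sqr expnMn.
rewrite -(@ltn_pmul2r q) //; nia.
Qed.

(* Descent by the Vieta involution [z |-> x * y - z], as for Markov triples. *)
Lemma markov_like (d x y z : nat) : (0 < d <= 2)%N -> (0 < x)%N -> (0 < y)%N -> (0 < z)%N ->
  (x ^ 2 + y ^ 2 + z ^ 2 = x * y * z + d)%N -> [/\ x = 1, y = 1 & z = 1]%N.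
Proof.
move=> dB; have [n] := ubnP (x + y + z)%N.
elim: n x y z => // n IH x y z; rewrite ltnS.
wlog xy : x y z / (x <= y)%N.
  move=> W sn x0 y0 z0 E; case: (leqP x y) => h; first exact: W.
  by have [|||||->->->] := W y x z (ltnW h); rewrite // -?E; lia.
wlog yz : x y z xy / (y <= z)%N.
  move=> W sn x0 y0 z0 E; case: (leqP y z) => h; first exact: W.
  case: (leqP x z) => h'.
    by have [|||||->->->] := W x z y h' (ltnW h); rewrite // -?E; lia.
  by have [|||||->->->] := W z x y (ltnW h') xy; rewrite // -?E; lia.
move=> sn x0 y0 z0 E; have := ltnW (ltnSn x).
case: (ltngtP x 2) => [x1|x3|x2] _.
(* Here 2 y z <= y^2 + z^2 = y z + d - 1, so y z <= 1. *)
- have xE : x = 1%N by lia.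
  rewrite {}xE in E *; have : (y * z <= 1)%N by nia.
  by split=> //; nia.
(* For x >= 3, z is the larger root of T^2 - x y T + x^2 + y^2 - d, so replacing it by x y - z
   lowers the sum; induction then gives x = 1, a contradiction. *)
- have lt : (x * y < 2 * z)%N.
    rewrite ltnNge; apply/negP => h.
    have h1 : (z * z + y * (x * y) <= x * y * z + y * y)%N by nia.
    have h2 : (3 * (y * y) <= y * (x * y))%N by nia.
    have h3 : (x * x <= y * y)%N by nia.
    nia.
  have zxy : (z < x * y)%N by nia.
  have [|||||xE _ _] := IH x y (x * y - z)%N; try nia.
(* For x = 2 the equation reads (z - y)^2 = d - 4 < 0. *)
- exfalso; rewrite x2 in E; nia.
Qed.

(** Dividing a b = t^2 by g = gcd(a, t) gives a' b = g t'^2 with a' prime to t' and g prime to b;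
    hence a' and g divide each other. *)
Lemma coprime_mul_square (a b t : nat) : coprime a b -> (a * b = t ^ 2)%N ->
  a = (gcdn a t ^ 2)%N.
Proof.
move=> ab E; have [t0|t0] := posnP t.
  move/eqP: E; rewrite t0 gcdn0 muln_eq0 => /orP[] /eqP z; first by rewrite z.
  by move: ab; rewrite z /coprime gcdn0 => /eqP ->.
set g := gcdn a t; have g0 : (0 < g)%N by rewrite gcdn_gt0 t0 orbT.
have [a' aE] := dvdnP (dvdn_gcdl a t); have [t' tE] := dvdnP (dvdn_gcdr a t).
rewrite -/g in aE tE.
have co : coprime a' t'.
  by rewrite /coprime -(eqn_pmul2r g0) mul1n muln_gcdl -aE -tE.
have E' : (a' * b = g * t' ^ 2)%N.
  by apply/eqP; rewrite -(eqn_pmul2r g0); move/eqP: E; rewrite aE tE; lia.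
have d1 : (a' %| g)%N.
  by rewrite -(Gauss_dvdl _ (coprimeXr 2 co)) -E' dvdn_mulr.
have d2 : (g %| a')%N.
  have gb : coprime g b by apply: coprime_dvdl ab; apply: dvdn_gcdl.
  by rewrite -(Gauss_dvdl _ gb) E' dvdn_mulr.
by rewrite {1}aE (eqP (_ : a' == g)) ?mulnn // eqn_dvd d1.
Qed.

Lemma sum_gt_of_sum_sq_gt (a b c t : nat) :
  (0 < a)%N -> (0 < b)%N -> (0 < c)%N ->
  coprime a b -> coprime a c -> coprime b c -> (a, b, c) <> (1%N, 1%N, 1%N) ->
  (a * b * c = t ^ 2)%N -> (t < a + b + c)%N -> (t + 3 <= a + b + c)%N.
Proof.
move=> a0 b0 c0 ab ac bc n1 D lt; rewrite leqNgt; apply/negP => gt.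
have aE := coprime_mul_square a (b * c) t; have bE := coprime_mul_square b (a * c) t.
have cE := coprime_mul_square c (a * b) t.
move: aE bE cE; rewrite !coprimeMr ab ac bc ![coprime _ a]coprime_sym ab ac.
rewrite [coprime c b]coprime_sym bc.
move=> /(_ isT) aE /(_ isT) bE /(_ isT) cE.
have {}aE : a = (gcdn a t ^ 2)%N by apply: aE; rewrite mulnA.
have {}bE : b = (gcdn b t ^ 2)%N by apply: bE; rewrite mulnCA mulnA.
have {}cE : c = (gcdn c t ^ 2)%N by apply: cE; rewrite mulnC.
move: (gcdn a t) (gcdn b t) (gcdn c t) aE bE cE => x y z aE bE cE.
have tE : t = (x * y * z)%N by apply/eqP; rewrite -eqn_sqr -D aE bE cE !expnMn.
(* By [lt] and [gt] the defect a + b + c - t is 1 or 2. *)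
apply: n1; have [|||||xE yE zE] := markov_like (a + b + c - t) x y z.
- by move: lt gt; clear; lia.
- by move: a0; rewrite aE; case: (x).
- by move: b0; rewrite bE; case: (y).
- by move: c0; rewrite cE; case: (z).
- by rewrite -aE -bE -cE -tE subnKC // ltnW.
by rewrite aE bE cE xE yE zE.
Qed.

(** * Order of vanishing and gradings *)

Section Order.
Variable R : idomainType.
Implicit Types p q : {poly R}.

Definition vanishing (r : nat) p := forall d, (d < r)%N -> p`_d = 0.

Lemma vanishingD r p q : vanishing r p -> vanishing r q -> vanishing r (p + q).
Proof. by move=> pr qr d dr; rewrite coefD pr ?qr ?addr0. Qed.

Lemma vanishing_mul r s p q :
  vanishing r p -> vanishing s q -> vanishing (r + s) (p * q).
Proof.
move=> pr qs d drs; rewrite coefM big1 // => i _.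
case: (ltnP i r) => ir; first by rewrite pr // mul0r.
by rewrite qs ?mulr0 // ltn_subLR; [apply: leq_trans drs _; rewrite leq_add2r | rewrite -ltnS].
Qed.

Lemma coef_mul_vanishing r s p q : vanishing r p -> vanishing s q ->
  (p * q)`_(r + s) = p`_r * q`_s.
Proof.
move=> pr qs; have h : (r < (r + s).+1)%N by rewrite ltnS leq_addr.
rewrite coefM (bigD1 (Ordinal h)) //= addKn big1 ?addr0 // => i; rewrite -val_eqE /= => ir.
case: (ltngtP i r) ir => // ir _; first by rewrite pr // mul0r.
by rewrite qs ?mulr0 // ltn_subLR ?ltn_add2r // -ltnS.
Qed.

(** Once the coefficients of p below d vanish, coefficient d of the product is p_d q_0. This removes
    the denominators in a symbolic power. *)
Lemma vanishing_cancel r p q : vanishing r (p * q) -> q`_0 != 0 -> vanishing r p.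
Proof.
move=> pqr q0 d; elim/ltn_ind: d => d IH dr.
have pd : vanishing d p by move=> e ed; apply: IH (ltn_trans ed dr).
have q0' : vanishing 0 q by [].
have := coef_mul_vanishing _ _ _ _ pd q0'.
by rewrite addn0 pqr // => /esym/eqP; rewrite mulf_eq0 (negPf q0) orbF => /eqP.
Qed.

Lemma vanishing_order p : p != 0 -> exists2 r, vanishing r p & p`_r != 0.
Proof.
move=> p0; have ex : exists r, p`_r != 0.
  by exists (size p).-1; rewrite -lead_coefE lead_coef_eq0.
case: (ex_minnP ex) => r pr rmin; exists r => // d dr.
by apply/eqP; apply: contraTT dr => pd; rewrite -leqNgt rmin.
Qed.

(** Lowest and highest degrees are both additive over a domain; they coincide for the product, hence
    for each factor. *)
Lemma factor_of_monomial n p q : p != 0 -> q != 0 ->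
  (forall d, d != n -> (p * q)`_d = 0) ->
  exists i, forall d, d != i -> p`_d = 0.
Proof.
move=> p0 q0 pqn; have [i pi pi0] := vanishing_order _ p0.
have [j qj qj0] := vanishing_order _ q0; exists i => d di.
have ijn : (i + j)%N = n.
  apply/eqP; apply: contraT => /pqn.
  by rewrite coef_mul_vanishing // => /eqP; rewrite mulf_eq0 (negPf pi0) (negPf qj0).
have sz : (size (p * q)).-1 = n.
  by apply/eqP; apply: contraT => /pqn/eqP; rewrite -lead_coefE lead_coef_eq0 mulf_eq0
    (negPf p0) (negPf q0).
have [si sj] : (i < size p)%N /\ (j < size q)%N.
  by split; rewrite ltnNge; [apply: contra_neqN pi0|apply: contra_neqN qj0] => /leq_sizeP ->.
have szp : size p = i.+1 by move: sz; rewrite size_mul //; lia.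
case: (ltngtP d i) di => // di _; first exact: pi.
by rewrite nth_default // szp.
Qed.
End Order.

Section Grading.
Variables (K : fieldType) (n : nat) (mf : measure n).
Local Notation S := {mpoly K[n]}.

(** The grading as a ring morphism: the coefficient of T^d is the component of weight d. Orders and
    degrees of forms thus become those of univariate polynomials over a domain. *)
Definition grade : S -> {poly S} :=
  mmap (polyC \o @mpolyC n K) (fun i => ('X_i)%:P * 'X^(mf U_(i)%MM)).

HB.instance Definition _ := GRing.RMorphism.copy grade
  (mmap (polyC \o @mpolyC n K) (fun i => ('X_i)%:P * 'X^(mf U_(i)%MM))).

Lemma gradeC c : grade c%:MP = c%:MP%:P.
Proof. by rewrite /grade mmapC. Qed.

Lemma gradeX i : grade 'X_i = ('X_i)%:P * 'X^(mf U_(i)%MM).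
Proof. by rewrite /grade mmapX mmap1U. Qed.

Lemma coef_grade d (f : S) : (grade f)`_d = pihomog mf d f.
Proof.
rewrite /grade /mmap coef_sum pihomogE big_mkcond [RHS]big_mkcond /=.
apply: eq_bigr => m _.
have -> : mmap1 (fun i => ('X_i)%:P * 'X^(mf U_(i)%MM)) m
    = ('X_[m] : S)%:P * 'X^(mf m).
  rewrite /mmap1; under eq_bigr do rewrite exprMn -exprM -rmorphXn.
  rewrite big_split /= -rmorph_prod -mpolyXE_id -expr_sum mfE.
  by congr (_ * 'X^_); apply: eq_bigr => i _; rewrite mulnC.
rewrite mulrA -polyCM mul_mpolyC coefCM coefXn eq_sym.
by case: eqP; rewrite ?mulr1 ?mulr0.
Qed.

Lemma grade_inj : injective grade.
Proof.
move=> f g E.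
rewrite (pihomog_partitionE (leq_maxl (mmeasure mf f) (mmeasure mf g))).
rewrite [RHS](pihomog_partitionE (leq_maxr (mmeasure mf f) (mmeasure mf g))).
by apply: eq_bigr => d _; rewrite -!coef_grade E.
Qed.

Lemma dhomog_factor d (f g : S) : f * g \is d.-homog for mf -> f * g != 0 ->
  exists e, f \is e.-homog for mf.
Proof.
move=> fg; rewrite mulf_eq0 negb_or => /andP[f0 g0].
have g_neq0 h : h != 0 -> grade h != 0 by rewrite -(inj_eq grade_inj) raddf0.
have [e|e He] := @factor_of_monomial _ d (grade f) (grade g) (g_neq0 _ f0) (g_neq0 _ g0).
  rewrite eq_sym => de; rewrite -rmorphM coef_grade; exact: pihomog_ne0 fg.
exists e; rewrite homog_piE; apply/eqP.
rewrite [RHS](@pihomog_partitionE _ _ mf (maxn e.+1 (mmeasure mf f)) _ (leq_maxr _ _)).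
have le : (e < maxn e.+1 (mmeasure mf f))%N by rewrite leq_maxl.
rewrite (bigD1 (Ordinal le)) //= big1 ?addr0 // => i; rewrite -val_eqE /= => ie.
by rewrite -coef_grade He.
Qed.

End Grading.
Arguments grade {K n}.

Lemma rmorph_mpoly_ext (K : fieldType) (n : nat) (T : comNzRingType)
    (phi psi : {rmorphism {mpoly K[n]} -> T}) :
  (forall c, phi c%:MP = psi c%:MP) -> (forall i, phi 'X_i = psi 'X_i) -> phi =1 psi.
Proof.
move=> hC hX f; rewrite (mpolyE f) !rmorph_sum; apply: eq_bigr => m _.
rewrite -mul_mpolyC !rmorphM /= hC mpolyXE_id !rmorph_prod; congr (_ * _).
by apply: eq_bigr => i _; rewrite !rmorphXn /= hX.
Qed.

(** * Symbolic powers *)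

Lemma ord3_ind (P : 'I_3 -> Prop) : P 0 -> P 1 -> P 2%:R -> forall i, P i.
Proof.
move=> P0 P1 P2 [[|[|[]]] //= h]; [move: P0|move: P1|move: P2];
  by congr P; apply: val_inj.
Qed.

Lemma wdegU (a b c : nat) :
  [/\ wdeg a b c U_(0%R)%MM = a, wdeg a b c U_(1%R)%MM = b & wdeg a b c U_(2%:R%R)%MM = c].
Proof. by rewrite !wdegE !mnm1E /= !(muln0, muln1, addn0, add0n). Qed.

(** * Toric coordinates adapted to the curve *)

Section TorusInverse.
Variables (F : fieldType) (x y z : F) (a b c p q : nat).
Hypotheses (x0 : x != 0) (y0 : y != 0) (pq : (a * p = b * q + 1)%N).

(** Together with the next two identities: T = x^p / y^q, 1 + U = y^a / x^b, 1 + V = z y^(cq) /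
    x^(cp) inverts the substitution made by [chart]. *)
Lemma torus_inverse1 : (x ^+ p / y ^+ q) ^+ a * (y ^+ a / x ^+ b) ^+ q = x.
Proof.
rewrite !expr_div_n -!exprM [(p * a)%N]mulnC pq exprD expr1 [(q * a)%N]mulnC.
by field; rewrite !expf_neq0.
Qed.

Lemma torus_inverse2 : (x ^+ p / y ^+ q) ^+ b * (y ^+ a / x ^+ b) ^+ p = y.
Proof.
rewrite !expr_div_n -!exprM pq exprD expr1 [(p * b)%N]mulnC [(q * b)%N]mulnC.
by field; rewrite !expf_neq0.
Qed.

Lemma torus_inverse3 :
  (x ^+ p / y ^+ q) ^+ c * (z * y ^+ (c * q) / x ^+ (c * p)) = z.
Proof.
rewrite !expr_div_n -!exprM [(p * c)%N]mulnC [(q * c)%N]mulnC.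
by field; rewrite !expf_neq0.
Qed.
End TorusInverse.

Section Chart.
Variables (k : fieldType) (a b c p q : nat).
Local Notation S := {mpoly k[3]}.
Local Notation X := ('X_0 : S).
Local Notation Y := ('X_1 : S).
Local Notation Z := ('X_(2%:R) : S).

(* When [a * p = b * q + 1] the exponent matrix is unimodular, so this is a
   change of coordinates on the torus; the monomial curve becomes [Y = Z = 0]. *)
Definition chart : S -> S := mmap (@mpolyC 3 k)
  (tnth [tuple X ^+ a * (1 + Y) ^+ q; X ^+ b * (1 + Y) ^+ p; X ^+ c * (1 + Z)]).

HB.instance Definition _ := GRing.RMorphism.copy chart (mmap (@mpolyC 3 k)
  (tnth [tuple X ^+ a * (1 + Y) ^+ q; X ^+ b * (1 + Y) ^+ p; X ^+ c * (1 + Z)])).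

Lemma chartC d : chart d%:MP = d%:MP.
Proof. by rewrite /chart mmapC. Qed.

Lemma chartX : [/\ chart X = X ^+ a * (1 + Y) ^+ q,
  chart Y = X ^+ b * (1 + Y) ^+ p & chart Z = X ^+ c * (1 + Z)].
Proof. by rewrite /chart !mmapX !mmap1U. Qed.

(** The weights 0, 1, 1 measure the degree in (Y, Z), so this is the expansion transverse to the
    curve Y = Z = 0. *)
Definition taylor : S -> {poly S} := grade (wdeg 0 1 1) \o chart.
HB.instance Definition _ := GRing.RMorphism.copy taylor (grade (wdeg 0 1 1) \o chart).

Lemma taylorC d : taylor d%:MP = d%:MP%:P.
Proof. by rewrite /taylor /= chartC gradeC. Qed.

Lemma grade_taylor :
  [/\ grade (wdeg 0 1 1) X = X%:P, grade (wdeg 0 1 1) Y = Y%:P * 'X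
    & grade (wdeg 0 1 1) Z = Z%:P * 'X].
Proof.
by have [h0 h1 h2] := wdegU 0 1 1; rewrite !gradeX /= h0 h1 h2 expr0 !expr1 mulr1.
Qed.

Lemma taylorX : [/\ taylor X = X%:P ^+ a * (1 + Y%:P * 'X) ^+ q,
  taylor Y = X%:P ^+ b * (1 + Y%:P * 'X) ^+ p
  & taylor Z = X%:P ^+ c * (1 + Z%:P * 'X)].
Proof.
have [h0 h1 h2] := chartX; have [g0 g1 g2] := grade_taylor.
by rewrite /taylor /= h0 h1 h2 !(rmorphM, rmorphXn, rmorphD, rmorph1) /= g0 g1 g2.
Qed.

(** At Y = Z = 0 the chart is the parametrisation by X^a, X^b, X^c. With the converse [taylor0], the
    constant Taylor coefficient and [curve_map] determine each other. *)
Lemma curve_mapE (f : S) :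
  curve_map a b c f = mmap (@polyC k) (tnth [tuple 'X; 0; 0]) ((taylor f)`_0).
Proof.
pose kappa : S -> {poly k} := mmap (@polyC k) (tnth [tuple 'X; 0; 0]).
pose phi : {rmorphism S -> {poly k}} := mmap (@polyC k) (tnth [tuple 'X^a; 'X^b; 'X^c]).
pose psi : {rmorphism S -> {poly k}} :=
  mmap (@polyC k) (tnth [tuple 'X; 0; 0]) \o (horner_eval 0 \o taylor).
have kX : kappa X = 'X by rewrite /kappa mmapX mmap1U.
suff /(_ f) : phi =1 psi by rewrite /psi /= horner_evalE horner_coef0.
apply: rmorph_mpoly_ext => [d|].
  by rewrite /phi /psi /= mmapC horner_evalE taylorC hornerC mmapC.
have [h0 h1 h2] := taylorX.
by apply: ord3_ind; rewrite /phi /psi /= horner_evalE ?h0 ?h1 ?h2 mmapX mmap1U !hornerE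
  ?expr1n ?mulr1 rmorphXn /= -/kappa kX.
Qed.

Lemma taylor0 (f : S) : (taylor f)`_0 = horner_alg 'X_0 (curve_map a b c f).
Proof.
pose phi : {rmorphism S -> S} := horner_eval 0 \o taylor.
pose psi : {rmorphism S -> S} := horner_alg (X : S) \o
   mmap (@polyC k) (tnth [tuple 'X^a; 'X^b; 'X^c]).
suff /(_ f) : phi =1 psi by rewrite /phi /= horner_evalE horner_coef0.
apply: rmorph_mpoly_ext => [d|].
  by rewrite /phi /psi /= mmapC horner_evalE taylorC hornerC horner_algC alg_mpolyC.
have [h0 h1 h2] := taylorX.
by apply: ord3_ind; rewrite /phi /psi /= horner_evalE ?h0 ?h1 ?h2 mmapX mmap1U !hornerE
  ?expr1n ?mulr1 rmorphXn /= horner_algX.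
Qed.

Lemma curve_idealE (f : S) : (f \in curve_ideal a b c) = ((taylor f)`_0 == 0).
Proof.
rewrite inE; apply/eqP/eqP => E; first by rewrite taylor0 E rmorph0.
by rewrite curve_mapE E rmorph0.
Qed.

(** Elements of the ideal have order at least 1 and orders add up, so the numerator has order at
    least r; the denominator s has nonzero constant coefficient and cancels. *)
Lemma symbolic_power_vanishing r (f : S) :
  symbolic_power (curve_ideal a b c) r f -> vanishing _ r (taylor f).
Proof.
move=> [g [s [[m [u [h [hI ->]]]] sI E]]].
have s0 : s != 0 by apply: contraNneq sI => ->; rewrite curve_idealE rmorph0 coef0.
have fs : f * s = \sum_(i < m) u i * \prod_(j < r) h i j.
  by apply/eqP; rewrite -tofrac_eq tofracM E divfK // tofrac_eq0.
apply: (@vanishing_cancel _ _ _ (taylor s)); last by rewrite -curve_idealE.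
rewrite -rmorphM fs rmorph_sum /=.
elim/big_ind: _ => [d _|? ? ? ?|i _]; [exact: coef0|exact: vanishingD|].
rewrite rmorphM rmorph_prod; apply: (vanishing_mul _ 0 r) => //.
have : forall j, (taylor (h i j))`_0 = 0 by move=> j; apply/eqP; rewrite -curve_idealE.
elim: (r) (h i) => [|n IH] v v0; first by [].
by rewrite big_ord_recl; apply: (vanishing_mul _ 1 n); [case|apply: IH].
Qed.

End Chart.

Section IdealPower.
Variables (A : comNzRingType) (I : {pred A}).

Lemma ideal_power_0 r : ideal_power I r 0.
Proof. by exists 0%N, (fun=> 0), (fun=> fun=> 0); split=> [[]|]; rewrite ?big_ord0. Qed.

Lemma ideal_power_1 : ideal_power I 0 1.
Proof.
exists 1%N, (fun=> 1), (fun=> fun=> 1); split=> [_ []//|].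
by rewrite big_ord1 big_ord0 mulr1.
Qed.

Lemma ideal_powerD r f g : ideal_power I r f -> ideal_power I r g -> ideal_power I r (f + g).
Proof.
move=> [m1 [u1 [h1 [h1I ->]]]] [m2 [u2 [h2 [h2I ->]]]].
exists (m1 + m2)%N,
  (fun i => match split i with inl j => u1 j | inr j => u2 j end),
  (fun i => match split i with inl j => h1 j | inr j => h2 j end).
split=> [i j|]; first by case: (split i).
rewrite big_split_ord; congr (_ + _); apply: eq_bigr => i _.
  by have /= -> := unsplitK (inl i : 'I_m1 + 'I_m2).
by have /= -> := unsplitK (inr i : 'I_m1 + 'I_m2).
Qed.

Lemma ideal_powerMl r f g : ideal_power I r g -> ideal_power I r (f * g).
Proof.
move=> [m [u [h [hI ->]]]]; exists m, (fun i => f * u i), h; split=> //.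
by rewrite mulr_sumr; apply: eq_bigr => i _; rewrite mulrA.
Qed.

Lemma ideal_powerS r f g : ideal_power I r f -> g \in I -> ideal_power I r.+1 (f * g).
Proof.
move=> [m [u [h [hI ->]]]] gI.
exists m, u, (fun i j => if unlift ord_max j is Some j' then h i j' else g).
split=> [i j|]; first by case: unliftP.
rewrite mulr_suml; apply: eq_bigr => i _; rewrite big_ord_recr /= unlift_none mulrA.
congr (_ * _ * _); apply: eq_bigr => j _.
have -> : widen_ord (leqnSn r) j = lift ord_max j by apply/val_inj/esym/lift_max.
by rewrite liftK.
Qed.

Lemma ideal_power_pred r f : ideal_power I r.+1 f -> ideal_power I r f.
Proof.
move=> [m [u [h [hI ->]]]].
exists m, (fun i => u i * h i ord_max), (fun i j => h i (lift ord_max j)); split=> //.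
apply: eq_bigr => i _; rewrite big_ord_recr /= -mulrA; congr (_ * _).
rewrite mulrC; congr (_ * _); apply: eq_bigr => j _; congr h.
by apply/val_inj/esym/lift_max.
Qed.

Lemma ideal_power_leq r s f : (r <= s)%N -> ideal_power I s f -> ideal_power I r f.
Proof.
move=> /subnK <-; elim: (s - r)%N => // n IH h; apply: IH.
exact: ideal_power_pred.
Qed.

Lemma ideal_powerX r f g n : ideal_power I r f -> g \in I ->
  ideal_power I (r + n) (f * g ^+ n).
Proof.
move=> fr gI; elim: n => [|n IH]; first by rewrite addn0 expr0 mulr1.
by rewrite exprSr mulrA addnS; apply: ideal_powerS.
Qed.

End IdealPower.

Lemma mcoeff_pihomog (K : fieldType) (n : nat) (mf : measure n) (f : {mpoly K[n]}) m :
  (pihomog mf (mf m) f)@_m = f@_m.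
Proof.
set N := maxn (mf m).+1 (mmeasure mf f).
have lt : (mf m < N)%N by rewrite leq_maxl.
rewrite [in RHS](pihomog_partitionE (leq_maxr (mf m).+1 (mmeasure mf f))).
rewrite [RHS]raddf_sum [RHS](bigD1 (Ordinal lt)) //= [X in _ = _ + X]big1 ?addr0 // => i; rewrite -val_eqE /= => im.
by apply: dhomog_nemf_coeff (pihomogP _ _ _) _; rewrite eq_sym.
Qed.

HB.instance Definition _ (k : fieldType) (a b c : nat) :=
  GRing.RMorphism.copy (@curve_map k a b c)
    (mmap (@polyC k) (tnth [tuple 'X^a; 'X^b; 'X^c])).

Lemma mpolyX3E (K : fieldType) (m : 'X_{1..3}) :
  'X_[m] = 'X_0 ^+ m 0 * 'X_1 ^+ m 1 * 'X_(2%:R) ^+ m (2%:R : 'I_3) :> {mpoly K[3]}.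
Proof.
rewrite mpolyXE_id !big_ord_recl big_ord0 mulr1 mulrA.
by congr ('X_ _ ^+ m _ * 'X_ _ ^+ m _ * 'X_ _ ^+ m _); apply: val_inj.
Qed.

Lemma monomial_fraction (F : fieldType) (x y A B C : F) (p q b e m0 m1 m2 : nat) :
  (forall n, x ^+ n != 0) -> (forall n, y ^+ n != 0) ->
  C * ((x ^+ p / y ^+ q) ^+ m0 * (A / x ^+ b) ^+ m1 * (B / x ^+ e) ^+ m2) =
  C * x ^+ (p * m0) * A ^+ m1 * B ^+ m2 /
    (y ^+ (q * m0) * x ^+ (b * m1) * x ^+ (e * m2)).
Proof.
move=> X0 Y0; rewrite !expr_div_n -!exprM.
by field; rewrite !X0 Y0.
Qed.

Section SymbolicPower.
Variables (k : fieldType) (a b c p q : nat).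
Hypothesis pq : (a * p = b * q + 1)%N.
Local Notation S := {mpoly k[3]}.
Local Notation X := ('X_0 : S).
Local Notation Y := ('X_1 : S).
Local Notation Z := ('X_(2%:R) : S).
Local Notation I := (@curve_ideal k a b c).
Local Notation chart := (chart k a b c p q).
Local Notation taylor := (taylor k a b c p q).

Let curve_mapX : [/\ curve_map a b c X = 'X^a, curve_map a b c Y = 'X^b
  & curve_map a b c Z = 'X^c].
Proof. by rewrite /curve_map !mmapX !mmap1U. Qed.

(** Numerators of the inverse coordinates: U = A / X^b and V = B / X^(cp). *)
Let A : S := Y ^+ a - X ^+ b.
Let B : S := Z * Y ^+ (c * q) - X ^+ (c * p).

Let A_in : A \in I.
Proof.
have [hX hY _] := curve_mapX.
by rewrite inE rmorphB !rmorphXn /= hX hY -!exprM mulnC subrr.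
Qed.

Let B_in : B \in I.
Proof.
have [hX hY hZ] := curve_mapX.
rewrite inE rmorphB rmorphM !rmorphXn /= hX hY hZ -!exprM -exprD subr_eq0.
by apply/eqP; congr (_ ^+ _); rewrite mulnCA [in RHS]mulnCA pq; ring.
Qed.

Let notin_curve_idealM (s t : S) : s \notin I -> t \notin I -> s * t \notin I.
Proof. by rewrite !inE rmorphM mulf_eq0 negb_or => -> ->. Qed.

Let notin_curve_idealX (s : S) n : s \notin I -> s ^+ n \notin I.
Proof. by rewrite !inE rmorphXn; apply: expf_neq0. Qed.

Let X_notin : X \notin I.
Proof. by have [hX _ _] := curve_mapX; rewrite inE hX monic_neq0 ?monicXn. Qed.

Let Y_notin : Y \notin I.
Proof. by have [_ hY _] := curve_mapX; rewrite inE hY monic_neq0 ?monicXn. Qed.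

Let tofrac_notin (s : S) : s \notin I -> tofrac s != 0.
Proof. by rewrite tofrac_eq0; apply: contraNneq => ->; rewrite inE rmorph0. Qed.

Let fX := tofrac X.
Let fY := tofrac Y.
Let fZ := tofrac Z.

Let unchart : {rmorphism S -> {fraction S}} := mmap (@tofrac S \o @mpolyC 3 k)
  (tnth [tuple fX ^+ p / fY ^+ q; fY ^+ a / fX ^+ b - 1;
    fZ * fY ^+ (c * q) / fX ^+ (c * p) - 1]).

Let unchartX : [/\ unchart X = fX ^+ p / fY ^+ q, unchart Y = fY ^+ a / fX ^+ b - 1
  & unchart Z = fZ * fY ^+ (c * q) / fX ^+ (c * p) - 1].
Proof. by rewrite /unchart /= !mmapX !mmap1U. Qed.

Let chartK f : unchart (chart f) = tofrac f.
Proof.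
have X0 : fX != 0 by apply: tofrac_notin.
have Y0 : fY != 0 by apply: tofrac_notin.
pose phi : {rmorphism S -> {fraction S}} := unchart \o chart.
apply: (@rmorph_mpoly_ext _ _ _ phi (@tofrac S)) => [d|].
  by rewrite /phi /= chartC mmapC.
have [h0 h1 h2] := chartX k a b c p q; have [u0 u1 u2] := unchartX.
apply: ord3_ind; rewrite /phi [LHS]/= ?h0 ?h1 ?h2 rmorphM !rmorphXn rmorphD rmorph1.
- rewrite u0 u1 [1 + _]addrC subrK; exact: (@torus_inverse1 _ fX fY a b p q X0 Y0 pq).
- rewrite u0 u1 [1 + _]addrC subrK; exact: (@torus_inverse2 _ fX fY a b p q X0 Y0 pq).
- rewrite u0 u2 [1 + _]addrC subrK; exact: (@torus_inverse3 _ fX fY fZ c p q X0 Y0).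
Qed.

Lemma chart_inj : injective chart.
Proof. by move=> f g E; apply/eqP; rewrite -tofrac_eq -!chartK E. Qed.

(** Pull [chart f] back monomial by monomial: Y^m1 Z^m2 becomes A^m1 B^m2 over a power of X, and
    X^m0 a quotient of monomials. The numerator lies in the power m1 + m2 of the ideal; the
    denominator, a monomial in X and Y, lies outside the ideal. *)
Lemma vanishing_symbolic_power r (f : S) : vanishing _ r (taylor f) -> symbolic_power I r f.
Proof.
move=> fr; suff: exists g s, [/\ ideal_power I r g, s \notin I &
    unchart (chart f) = tofrac g / tofrac s] by rewrite chartK.
rewrite (mpolyE (chart f)) rmorph_sum big_seq.
elim/big_ind: _ => [|F G|m m_in].
- exists 0, 1; split; rewrite ?tofrac0 ?mul0r //; first exact: ideal_power_0.
  by rewrite inE rmorph1 oner_eq0.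
- move=> [g [s [gr sI ->]]] [h [t [hr tI ->]]].
  exists (t * g + s * h), (s * t); split; last 1 first.
  + by rewrite addf_div ?tofrac_notin // [t * g]mulrC [s * h]mulrC tofracD !tofracM.
  + by apply: ideal_powerD; apply: ideal_powerMl.
  + exact: notin_curve_idealM.
have [u0 u1 u2] := unchartX.
have X0 n : fX ^+ n != 0 by rewrite expf_neq0 ?tofrac_notin.
have Y0 n : fY ^+ n != 0 by rewrite expf_neq0 ?tofrac_notin.
pose m0 := m 0; pose m1 := m 1; pose m2 := m (2%:R : 'I_3).
exists (((chart f)@_m)%:MP * X ^+ (p * m0) * A ^+ m1 * B ^+ m2),
  (Y ^+ (q * m0) * X ^+ (b * m1) * X ^+ (c * p * m2)); split.
(* A monomial with m1 + m2 < r would show up in a Taylor coefficient that vanishes. *)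
- apply: (@ideal_power_leq _ _ _ (0 + m1 + m2)).
    rewrite leqNgt; apply/negP => lt; move: m_in; rewrite mcoeff_msupp.
    have wE : wdeg 0 1 1 m = (m1 + m2)%N by rewrite wdegE mul0n !mul1n.
    rewrite -(@mcoeff_pihomog _ _ (wdeg 0 1 1)) /= wE -coef_grade.
    by have := fr _ lt; rewrite /taylor /= => ->; rewrite mcoeff0 eqxx.
  apply: ideal_powerX => //; apply: ideal_powerX => //.
  by rewrite -[_ * _]mulr1; apply/ideal_powerMl/ideal_power_1.
- by do !apply: notin_curve_idealM; apply: notin_curve_idealX.
rewrite -mul_mpolyC [unchart (_ * _)]rmorphM mpolyX3E !(rmorphM, rmorphXn).
have -> : unchart ((chart f)@_m)%:MP = tofrac ((chart f)@_m)%:MP by rewrite /unchart /= mmapC.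
have {}u1 : unchart Y = tofrac A / fX ^+ b.
  by rewrite u1 rmorphB !rmorphXn mulrBl mulfV.
have {}u2 : unchart Z = tofrac B / fX ^+ (c * p).
  by rewrite u2 rmorphB rmorphM !rmorphXn mulrBl mulfV.
rewrite u0 u1 u2 -/fX -/fY -/m0 -/m1 -/m2.
exact: (monomial_fraction _ fX fY (tofrac A) (tofrac B) (tofrac ((chart f)@_m)%:MP) p q b (c * p) m0 m1 m2 X0 Y0).
Qed.

Lemma symbolic_powerE r (f : S) : symbolic_power I r f <-> vanishing _ r (taylor f).
Proof.
by split; [apply: symbolic_power_vanishing | apply: vanishing_symbolic_power].
Qed.

End SymbolicPower.

(** * Negative curves *)

Lemma card_triangle r :
  (#|[set x : 'I_r * 'I_r | x.1 + x.2 < r]| = r * (r + 1) %/ 2)%N.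
Proof.
have -> : (#|[set x : 'I_r * 'I_r | x.1 + x.2 < r]| = \sum_(i < r) i.+1)%N.
  rewrite -sum1dep_card -(pair_big_dep xpredT (fun i j : 'I_r => (i + j < r)%N) (fun _ _ => 1%N)) /=.
  rewrite [RHS](reindex_inj rev_ord_inj); apply: eq_bigr => i _ /=.
  rewrite subnSK // (eq_bigl (fun j : 'I_r => (j < r - i)%N)) => [|j]; last by rewrite ltn_subRL.
  by rewrite -(big_ord_widen r (fun=> 1%N)) ?leq_subr // sum1_card card_ord.
elim: r => [|r IH]; first by rewrite big_ord0.
by rewrite big_ord_recr /= IH; lia.
Qed.

Section Negative.
Variables (k : fieldType) (a b c p q : nat).
Hypotheses (a0 : (0 < a)%N) (b0 : (0 < b)%N) (c0 : (0 < c)%N).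
Hypothesis pq : (a * p = b * q + 1)%N.
Local Notation S := {mpoly k[3]}.
Local Notation X := ('X_0 : S).
Local Notation Y := ('X_1 : S).
Local Notation Z := ('X_(2%:R) : S).
Local Notation chart := (chart k a b c p q).
Local Notation taylor := (taylor k a b c p q).

(** [chart] sends a variable of weight e to X^e times a polynomial free of X, so weight for (a, b,
    c) turns into degree in X. *)
Let grade_chart (f : S) : grade (wdeg 1 0 0) (chart f) = map_poly chart (grade (wdeg a b c) f).
Proof.
pose phi : {rmorphism S -> {poly S}} := grade (wdeg 1 0 0) \o chart.
pose psi : {rmorphism S -> {poly S}} := map_poly chart \o grade (wdeg a b c).
apply: (@rmorph_mpoly_ext _ _ _ phi psi) => [d|].
  by rewrite /phi /psi /= chartC !gradeC map_polyC /= chartC.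
have [h0 h1 h2] := chartX k a b c p q.
have [v0 v1 v2] := wdegU 1 0 0; have [w0 w1 w2] := wdegU a b c.
have g0 : grade (wdeg 1 0 0) X = X%:P * 'X by rewrite gradeX /= v0.
have g1 : grade (wdeg 1 0 0) Y = Y%:P by rewrite gradeX /= v1 mulr1.
have g2 : grade (wdeg 1 0 0) Z = Z%:P by rewrite gradeX /= v2 mulr1.
apply: ord3_ind; rewrite /phi /psi /= ?h0 ?h1 ?h2 gradeX /= ?w0 ?w1 ?w2
  [RHS]rmorphM /= map_polyC map_polyXn /= ?h0 ?h1 ?h2 !(rmorphM, rmorphXn, rmorphD, rmorph1) /=
  ?g0 ?g1 ?g2 exprMn; ring.
Qed.

Lemma dhomog_chart n (f : S) :
  f \is n.-homog for (wdeg a b c) -> chart f \is n.-homog for (wdeg 1 0 0).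
Proof.
move=> fn; rewrite homog_piE -coef_grade grade_chart coef_map /= coef_grade.
by rewrite pihomog_dE.
Qed.

(* A form of degree [n] has multiplicity at least [r] as soon as
   [r (r + 1) / 2] of its Taylor coefficients vanish. *)
Lemma exists_vanishing n r d : has_dim (@homog_comp k a b c n) d ->
  (r * (r + 1) %/ 2 < d)%N ->
  exists f : S, [/\ f != 0, f \is n.-homog for (wdeg a b c) & vanishing _ r (taylor f)].
Proof.
move=> [e [eU eB]] rd.
pose T := [set x : 'I_r * 'I_r | (x.1 + x.2 < r)%N].
have cT : (#|T| < d)%N by rewrite card_triangle.
(* By [dhomog_chart] the X-exponent is always n, so only the pairs (i, j) with i + j < r impose
   conditions. *)
pose mon i j : 'X_{1..3} := [multinom tnth [tuple n; i; j] l | l < 3].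
pose M := \matrix_(i < d, j < #|T|)
  (chart (e i))@_(mon (enum_val j).1 (enum_val j).2).
(* [M] has fewer columns than rows; a left kernel vector is a form meeting all conditions. *)
have : kermx M != 0.
  rewrite -mxrank_eq0 mxrank_ker -lt0n subn_gt0.
  exact: leq_ltn_trans (rank_leq_col _) cT.
case/rowV0Pn => v /sub_kermxP vM v0.
exists (\sum_i v 0 i *: e i); have := eU v; set f := \sum_i _; rewrite inE => fn; split=> //.
  apply: contraNneq v0 => f0; have zU : 0 \in @homog_comp k a b c n by rewrite -f0; apply: eU.
  have [w [_ w_uniq]] := eB _ zU.
  rewrite -(w_uniq v) //; apply/eqP/w_uniq; rewrite big1 // => j _.
  by rewrite mxE scale0r.
move=> s sr; rewrite /taylor /= coef_grade pihomogE big_seq_cond big1 // => m /andP[m_in /eqP ms].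
have mn : m 0 = n.
  by have := dhomog_mf (dhomog_chart _ _ fn) m_in; rewrite /= wdegE !mul0n !addn0 mul1n.
move: ms; rewrite /= wdegE mul0n !mul1n add0n => ms.
have b1 : (m 1%R < r)%N by apply: leq_ltn_trans sr; rewrite -ms leq_addr.
have b2 : (m (2%:R%R : 'I_3) < r)%N by apply: leq_ltn_trans sr; rewrite -ms leq_addl.
have xT : (Ordinal b1, Ordinal b2) \in T by rewrite inE /= ms.
have := congr1 (fun u : 'rV_#|T| => u 0 (enum_rank_in xT (Ordinal b1, Ordinal b2))) vM.
rewrite !mxE; under eq_bigr do rewrite mxE enum_rankK_in //=.
have -> : mon (m 1) (m (2%:R : 'I_3)) = m.
  apply/mnmP; apply: ord3_ind; rewrite mnmE //.
move=> h; suff -> : (chart f)@_m = 0 by rewrite scale0r.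
rewrite /f rmorph_sum [LHS](raddf_sum (mcoeff m)) -[RHS]h; apply: eq_bigr => i _.
by rewrite -mul_mpolyC rmorphM /= chartC mcoeffCM.
Qed.

Lemma homog0_const (g : S) : g \is 0.-homog for (wdeg a b c) -> g = (g@_0%MM)%:MP.
Proof.
move=> /dhomogP gh; apply/mpolyP => m; rewrite mcoeffC.
case: eqP => [->|m0]; first by rewrite mulr1.
rewrite mulr0; apply: memN_msupp_eq0; apply/negP => /gh; rewrite /= wdegE => w.
by apply: m0; apply/mnmP; apply: ord3_ind; rewrite mnm0E; nia.
Qed.

Lemma homog0_unit (g : S) : g != 0 -> g \is 0.-homog for (wdeg a b c) -> g \is a GRing.unit.
Proof.
move=> g0 /homog0_const gE; rewrite gE in g0 *.
rewrite rmorph_unit // unitfE; apply: contraNneq g0 => ->.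
by rewrite mpolyC0.
Qed.

Lemma homog_pos_notin_unit n (g : S) : (0 < n)%N -> g != 0 ->
  g \is n.-homog for (wdeg a b c) -> g \isn't a GRing.unit.
Proof.
move=> n0 g0 gn; apply/negP => /unitrP[h [hg _]].
have : (h * g) \is 0.-homog for (wdeg a b c) by rewrite hg dhomog1.
move=> hg0; have hgn : h * g != 0 by rewrite hg oner_neq0.
have [e he] := dhomog_factor _ _ _ _ _ _ hg0 hgn.
have := dhomog_uniq hgn hg0 (dhomogM he gn).
by move/esym/eqP; rewrite addn_eq0 (gtn_eqF n0) andbF.
Qed.

Lemma taylor_neq0 (f : S) : f != 0 -> taylor f != 0.
Proof.
apply: contraNneq => E; apply/eqP/(chart_inj k a b c p q pq)/(grade_inj _ _ (wdeg 0 1 1)).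
by rewrite !rmorph0.
Qed.

Lemma intersection_lt0 n s : (n ^ 2 < a * b * c * s ^ 2)%N ->
  intersection a b c (n%:Z, - s%:Z) (n%:Z, - s%:Z) < 0.
Proof.
move=> ns; rewrite /intersection /= subr_lt0 mulrNN -!PoszM -!pmulrn.
by rewrite ltr_pdivrMr ?ltr0n ?muln_gt0 ?a0 ?b0 // -natrM ltr_nat mulnC !mulnn.
Qed.

(** If both conclusions fail, multiplying the reverse inequalities gives (D s t)^2 <= (m l)^2, which
    bounds the cross term; the three bounds together contradict the hypothesis. *)
Lemma sq_lt_split (D m l s t : nat) : ((m + l) ^ 2 < D * (s + t) ^ 2)%N ->
  (m ^ 2 < D * s ^ 2)%N \/ (l ^ 2 < D * t ^ 2)%N.
Proof.
move=> lt; have [|h1] := ltnP (m ^ 2) (D * s ^ 2); first by left.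
have [|h2] := ltnP (l ^ 2) (D * t ^ 2); first by right.
suff h3 : (D * (s * t) <= m * l)%N by exfalso; nia.
rewrite -leq_sqr !expnMn; apply: leq_trans (leq_mul h1 h2).
by rewrite mulnACA mulnn.
Qed.

(* A form of minimal degree with [n^2 < abc r^2] is irreducible: degrees and
   multiplicities are additive, so one of two factors inherits the inequality. *)
Lemma negative_curve_of_vanishing n r (f : S) : f != 0 ->
  f \is n.-homog for (wdeg a b c) -> vanishing _ r (taylor f) ->
  (n ^ 2 < a * b * c * r ^ 2)%N -> has_negative_curve k a b c.
Proof.
elim/ltn_ind: n r f => n IH r f f0 fn fr nr.
(* A nonzero constant has order 0, while the strict inequality forces r > 0. *)
have n0 : (0 < n)%N.
  rewrite lt0n; apply: contraNneq f0 => nz; move: fn nr; rewrite nz => /homog0_const fE r0.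
  have /fr : (0 < r)%N by move: r0; case: (r) => //; rewrite muln0.
  by rewrite fE taylorC coefC eqxx => ->.
(* The order s of f replaces r, since the multiplicity has to be exact. *)
have [s fs fs0] := vanishing_order _ _ (taylor_neq0 _ f0).
have rs : (r <= s)%N by rewrite leqNgt; apply: contraNN fs0 => sr; rewrite fr.
have ns : (n ^ 2 < a * b * c * s ^ 2)%N.
  by apply: leq_trans nr _; rewrite leq_mul2l leq_sqr rs orbT.
have [[g [h [fE gU hU]]]|irr] := boolp.EM (exists g h : S,
    [/\ f = g * h, g \isn't a GRing.unit & h \isn't a GRing.unit]); last first.
  exists f; split.
    split=> // [|g h fE]; first exact: homog_pos_notin_unit fn.
    have [|gU] := boolP (g \is a GRing.unit); first by left.
    have [|hU] := boolP (h \is a GRing.unit); first by right.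
    by case: irr; exists g, h.
  exists n, s; split; [by rewrite inE| |exact: intersection_lt0].
  split; first exact/(symbolic_powerE k a b c p q).
  by move/(symbolic_powerE k a b c p q pq)=> /(_ s (ltnSn s)) /eqP; apply/negP.
have [g0 h0] : g != 0 /\ h != 0.
  by apply/andP; move: f0; rewrite fE mulf_eq0 negb_or.
have [m gm] : exists m, g \is m.-homog for (wdeg a b c).
  by apply: (@dhomog_factor _ _ _ n g h); rewrite -fE.
have [l hl] : exists l, h \is l.-homog for (wdeg a b c).
  by apply: (@dhomog_factor _ _ _ n h g); rewrite mulrC -fE.
have nE : n = (m + l)%N by apply: dhomog_uniq f0 fn _; rewrite fE dhomogM.
have m0 : (0 < m)%N.
  by rewrite lt0n; apply: contraNneq gU => mz; move: gm; rewrite mz; apply: homog0_unit.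
have l0 : (0 < l)%N.
  by rewrite lt0n; apply: contraNneq hU => lz; move: hl; rewrite lz; apply: homog0_unit.
have [t gt gt0] := vanishing_order _ _ (taylor_neq0 _ g0).
have [u hu hu0] := vanishing_order _ _ (taylor_neq0 _ h0).
(* Coefficient t + u of [taylor f] is the product of the lowest coefficients of the factors, hence
   nonzero. *)
have stu : (s <= t + u)%N.
  rewrite leqNgt; apply/negP => /fs /eqP.
  by rewrite fE rmorphM /= coef_mul_vanishing // mulf_eq0 (negPf gt0) (negPf hu0).
have [||] := @sq_lt_split (a * b * c) m l t u.
- rewrite -nE; apply: leq_trans ns _.
  by rewrite leq_mul2l leq_sqr stu orbT.
- by apply: IH g0 gm gt; rewrite nE -[X in (X < _)%N]addn0 ltn_add2l.
- by apply: IH h0 hl hu; rewrite nE -[X in (X < _)%N]add0n ltn_add2r.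
Qed.

End Negative.

Lemma has_negative_curve_of_dim (k : fieldType) (a b c n r d : nat) :
  (0 < a)%N -> (0 < b)%N -> (0 < c)%N -> coprime a b ->
  (n ^ 2 < a * b * c * r ^ 2)%N -> has_dim (@homog_comp k a b c n) d ->
  (r * (r + 1) %/ 2 < d)%N -> has_negative_curve k a b c.
Proof.
move=> a0 b0 c0 ab nr nd rd.
(* Bezout supplies the unimodular exponents of [chart]. *)
have [p q pqE _] := egcdnP b a0.
have pq : (a * p = b * q + 1)%N by rewrite mulnC pqE (eqP ab) mulnC.
have [f [f0 fn fr]] := exists_vanishing k a b c p q n r d nd rd.
exact: (negative_curve_of_vanishing k a b c p q a0 b0 c0 pq n r f).
Qed.

(** * Condition (C2) and the final assembly *)

Lemma condC2_of_sum_sq_gt (R : realType) (k : fieldType) (a b c : nat) :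
  (0 < a)%N -> (0 < b)%N -> (0 < c)%N ->
  coprime a b -> coprime a c -> coprime b c -> (a, b, c) <> (1%N, 1%N, 1%N) ->
  (a * b * c < (a + b + c) ^ 2)%N -> condC2 k a b c R.
Proof.
move=> a0 b0 c0 ab ac bc n1 lt.
have D0 : (0 < a * b * c)%N by rewrite !muln_gt0 a0 b0.
have [/sqrt_natP[t tE]|/sqrt_natP nsq] := boolP ((Num.sqrt (a * b * c)%:R : R) \is a Num.int).
  have t0 : (0 < t)%N by move: D0; rewrite tE expn_gt0 orbF.
  have ts : (t + 3 <= a + b + c)%N.
    by apply: (sum_gt_of_sum_sq_gt a b c t) => //; rewrite -ltn_sqr -tE.
  (* With r = 3 t + 1, n is the largest integer below t r = 3 D + t. As dim S_(t - 1) >= 0 and s >=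
     t + 3, twice the dimension is at least 9 t^2 + 9 t + 3, one more than r (r + 1). *)
  pose n := ((t - 1) + a * b * c * 3)%N.
  have [d nd dE] := has_dim_homog k a b c a0 b0 c0 n.
  exists n, (1 + 3 * t)%N, d; split=> //.
  - by rewrite addn_gt0 muln_gt0 D0 orbT.
  - by rewrite ratio_lt_sqrt // /n tE -expnMn ltn_sqr; nia.
  rewrite ltn_divLR // -(ltr_nat rat) !natrM dE.
  rewrite lattice_points_shift // tE.
  have := lattice_points_ge0 a b c (t - 1).
  have : (t%:R + 3 <= (a + b + c)%:R :> rat) by rewrite -natrD ler_nat.
  move: (stretch _ _ _) => w; move: (a + b + c)%N => s ts' w0.
  rewrite !(natrD, natrM, natrX) natrB //; lra.
(* For irrational sqrt D, (C3) holds, and it is (C2) for n = abcq. *)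
have [|q [r [q0 r0 qr hr]]] := @points_of_sum_sq_gt R (a * b * c) (a + b + c) _ lt.
  by move=> t tE; apply: nsq; exists t.
have /(condC3E R k a b c a0 b0 c0 ab ac bc) [q' [r' [d [q0' r0' h1 h2 h3]]]] :
    exists q r : nat, [/\ (0 < q)%N, (0 < r)%N,
    (a * b * c * q ^ 2 < r ^ 2)%N &
    (r * (r + 1) < a * b * c * q ^ 2 + (a + b + c) * q + 2)%N] by exists q, r.
by exists (a * b * c * q')%N, r', d; split=> //; rewrite muln_gt0 D0.
Qed.

Theorem theorem4p3 (R : realType) (k : fieldType) (a b c : nat)
    (ha : (0 < a)%N) (hb : (0 < b)%N) (hc : (0 < c)%N)
    (hab : coprime a b) (hac : coprime a c) (hbc : coprime b c)
    (habc : (a, b, c) <> (1%N, 1%N, 1%N)) :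
  [/\ ~ (Num.sqrt (a * b * c)%:R : R) \is a Num.int ->
        (condC3 k a b c R <-> (a * b * c < (a + b + c) ^ 2)%N),
      (Num.sqrt (a * b * c)%:R : R) \is a Num.int ->
        (condC3 k a b c R <-> (9 * (a * b * c) < (a + b + c) ^ 2)%N)
    & (a * b * c < (a + b + c) ^ 2)%N ->
        condC2 k a b c R /\ has_negative_curve k a b c].
Proof.
split=> [nsq|/sqrt_natP[t tE]|lt].
- rewrite condC3E //; split=> [[q [r [q0 _]]]|]; first exact: sum_sq_gt_of_points.
  by apply: (points_of_sum_sq_gt R) => t tE; apply/nsq/sqrt_natP; exists t.
- by rewrite condC3E // tE points_square -[(9 * _)%N](expnMn 3 t 2) ltn_sqr.
have C2 : condC2 k a b c R by exact: condC2_of_sum_sq_gt.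
split=> //; have [n [r [d [n0 r0 nr nd rd]]]] := C2.
by apply: (has_negative_curve_of_dim k a b c n r d) => //; rewrite -(ratio_lt_sqrt R).
Qed.
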